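(* Every $\ell_\infty$-embeddable algebra and every $\ell_\infty$-embeddable Banach space is $\bigl(B(\ell_2)\setminus\widetilde{\mathcal{K}}(\ell_2)\bigr)$-embeddable.
   Context: All algebras are associative and complex; $\ell_\infty$ is the $C^*$-algebra of bounded complex sequences, $B(\ell_2)$ the $C^*$-algebra of bounded operators on the complex Hilbert space $\ell_2(\mathbb{N})$, $\mathcal{K}(\ell_2)$ the ideal of compact operators, and $\widetilde{\mathcal{K}}(\ell_2)=\mathcal{K}(\ell_2)\oplus\mathbb{C}1$ with $1$ the identity operator. Let $B$ be a $C^*$-algebra. A $B$-embedding of $A$ is an injective linear map $\phi\colon A\to B$ preserving the structure of $A$: isometric if $A$ is a Banach space; an algebra homomorphism if $A$ is an algebra; isometric and an algebra homomorphism if $A$ is a Banach algebra; a $^*$-homomorphism if $A$ is a $C^*$-algebra. $A$ is $B$-embeddable if a $B$-embedding of $A$ exists. For $Y\subset B$, $A$ is $(B\setminus Y)$-embeddable if there is a $B$-embedding $\phi$ of $A$ with $\phi(A)\cap Y=\{0\}$. *)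

(* Defs.v *)
From HB Require Import structures.
From mathcomp Require Import all_boot all_order all_algebra.
From mathcomp Require Import all_classical all_reals all_analysis.
From mathcomp Require Import complex.
From mathcomp Require Import ring lra.

Set Implicit Arguments.
Unset Strict Implicit.
Unset Printing Implicit Defensive.

Import Order.TTheory GRing.Theory Num.Theory.
Import numFieldNormedType.Exports.

Local Open Scope classical_set_scope.
Local Open Scope ring_scope.
Local Open Scope complex_scope.

(* Norms of modules over [R[i]] take (nonnegative real) values in [R[i]];
   [rnorm] is the same norm with values in [R]. *)
Definition rnorm (R : realType) (V : normedZmodType R[i]) (x : V) : R :=
  complex.Re `|x|.

Section rnorm.
Variable R : realType.

Lemma rnormE (V : normedZmodType R[i]) (x : V) : (rnorm x)%:C = `|x|.
Proof. by rewrite /rnorm RRe_real ?normr_real. Qed.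

Lemma rnorm_ge0 (V : normedZmodType R[i]) (x : V) : 0 <= rnorm x.
Proof. by rewrite -lecR rnormE normr_ge0. Qed.

Lemma rnormD (V : normedZmodType R[i]) (x y : V) :
  rnorm (x + y) <= rnorm x + rnorm y.
Proof. by rewrite -lecR rmorphD /= !rnormE ler_normD. Qed.

Lemma rnorm0 (V : normedZmodType R[i]) : rnorm (0 : V) = 0.
Proof. by rewrite /rnorm normr0. Qed.

Lemma rnorm_eq0 (V : normedZmodType R[i]) (x : V) : rnorm x = 0 -> x = 0.
Proof. by move=> x0; apply/normr0_eq0; rewrite -rnormE x0. Qed.

Lemma rnormM (a b : R[i]) : rnorm (a * b) = rnorm a * rnorm b.
Proof. by apply: complexI; rewrite rmorphM /= !rnormE normrM. Qed.

Lemma rnormZ (V : normedModType R[i]) (a : R[i]) (x : V) :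
  rnorm (a *: x) = rnorm a * rnorm x.
Proof. by apply: complexI; rewrite rmorphM /= !rnormE normrZ. Qed.

End rnorm.

(* Associative algebras, not assumed to have a unit (unlike [algType]). *)
HB.mixin Record Lmodule_isAssocAlgebra (K : pzRingType) A
    & GRing.Lmodule K A := {
  amul : A -> A -> A;
  amulA : associative amul;
  amulDl : left_distributive amul +%R;
  amulDr : right_distributive amul +%R;
  amulZl : forall (a : K) (x y : A), amul (a *: x) y = a *: amul x y;
  amulZr : forall (a : K) (x y : A), amul x (a *: y) = a *: amul x y
}.

#[short(type="assocAlgType")]
HB.structure Definition AssocAlgebra (K : pzRingType) :=
  {A of GRing.Lmodule K A & Lmodule_isAssocAlgebra K A}.

(* A normed algebra carries both structures used by [B]-embeddings. *)
HB.mixin Record AssocAlgebra_Normed_isNormedAlgebra (K : numFieldType) A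
    & NormedModule K A & AssocAlgebra K A := {
  normr_amul : forall x y : A, `|amul x y| <= `|x| * `|y|
}.

#[short(type="normedAlgType")]
HB.structure Definition NormedAlgebra (K : numFieldType) :=
  {A of NormedModule K A & AssocAlgebra K A
   & AssocAlgebra_Normed_isNormedAlgebra K A}.

Definition linf_pred (R : realType) : {pred nat -> R[i]} :=
  mem [set x : nat -> R[i] | exists M : R, forall n, rnorm (x n) <= M].
Arguments linf_pred : clear implicits.

Record linf (R : realType) := Linf {
  linf_val :> nat -> R[i];
  linf_valP : linf_val \in linf_pred R }.

HB.instance Definition _ (R : realType) := [isSub for @linf_val R].
HB.instance Definition _ (R : realType) := [Choice of linf R by <:].

Section linf.
Variable R : realType.
Implicit Types x y : linf R.

Lemma linf_submod_closed : submod_closed (linf_pred R).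
Proof.
split; first by apply/mem_set; exists 0 => n; rewrite rnorm0.
move=> a x y /set_mem[M xM] /set_mem[N yN]; apply/mem_set.
exists (rnorm a * M + N) => n; rewrite (le_trans (rnormD _ _))// lerD//.
by rewrite rnormM ler_wpM2l ?rnorm_ge0.
Qed.

HB.instance Definition _ :=
  GRing.isSubmodClosed.Build _ _ (linf_pred R) linf_submod_closed.
HB.instance Definition _ := [SubChoice_isSubLmodule of linf R by <:].

Definition linf_norm x : R := sup [set rnorm (x n) | n in setT].

Lemma linf_val_bound x : exists M : R, forall n, rnorm (x n) <= M.
Proof. exact: set_mem (linf_valP x). Qed.

Lemma linf_norm_ub x n : rnorm (x n) <= linf_norm x.
Proof.
apply: ub_le_sup; last by exists n.
by have [M xM] := linf_val_bound x; exists M => _ [k _ <-].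
Qed.

Lemma linf_norm_le x M : (forall n, rnorm (x n) <= M) -> linf_norm x <= M.
Proof.
move=> xM; apply: ge_sup; first by exists (rnorm (x 0%N)), 0%N.
by move=> _ [k _ <-].
Qed.

Lemma linf_norm_ge0 x : 0 <= linf_norm x.
Proof. exact: le_trans (rnorm_ge0 _) (linf_norm_ub x 0%N). Qed.

Lemma linf_normD x y :
  (linf_norm (x + y))%:C <= (linf_norm x)%:C + (linf_norm y)%:C.
Proof.
rewrite -rmorphD lecR; apply: linf_norm_le => n.
by rewrite (le_trans (rnormD _ _))// lerD ?linf_norm_ub.
Qed.

Lemma linf_normZ (a : R[i]) x :
  (linf_norm (a *: x))%:C = `|a| * (linf_norm x)%:C.
Proof.
rewrite -rnormE -rmorphM; congr (_%:C); apply/eqP; rewrite eq_le; apply/andP.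
split.
  by apply: linf_norm_le => n; rewrite rnormM ler_wpM2l ?rnorm_ge0 ?linf_norm_ub.
have [->|a0] := eqVneq (rnorm a) 0; first by rewrite mul0r linf_norm_ge0.
have {}a0 : 0 < rnorm a by rewrite lt_def a0 rnorm_ge0.
rewrite -ler_pdivlMl//; apply: linf_norm_le => n.
by rewrite ler_pdivlMl// -rnormM; exact: (linf_norm_ub (a *: x)).
Qed.

Lemma linf_norm0_eq0 x : (linf_norm x)%:C = 0 -> x = 0.
Proof.
move=> /complexI x0; apply/val_inj/funext => n; apply: rnorm_eq0.
by apply/eqP; rewrite eq_le rnorm_ge0 andbT -x0 linf_norm_ub.
Qed.

HB.instance Definition _ := Lmodule_isNormed.Build R[i] (linf R)
  linf_normD linf_normZ linf_norm0_eq0.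

Fact linf_mul_subproof x y : (fun n => x n * y n) \in linf_pred R.
Proof.
apply/mem_set; exists (linf_norm x * linf_norm y) => n.
by rewrite rnormM ler_pM ?rnorm_ge0 ?linf_norm_ub.
Qed.

Definition linf_mul x y : linf R := Linf (linf_mul_subproof x y).

Fact linf_mulA : associative linf_mul.
Proof. by move=> x y z; apply/val_inj/funext => n; rewrite /= mulrA. Qed.

Fact linf_mulDl : left_distributive linf_mul +%R.
Proof. by move=> x y z; apply/val_inj/funext => n; exact: mulrDl. Qed.

Fact linf_mulDr : right_distributive linf_mul +%R.
Proof. by move=> x y z; apply/val_inj/funext => n; exact: mulrDr. Qed.

Fact linf_mulZl (a : R[i]) x y : linf_mul (a *: x) y = a *: linf_mul x y.
Proof. by apply/val_inj/funext => n; rewrite /= /GRing.scale/= -mulrA. Qed.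

Fact linf_mulZr (a : R[i]) x y : linf_mul x (a *: y) = a *: linf_mul x y.
Proof. by apply/val_inj/funext => n; rewrite /= /GRing.scale/= mulrCA. Qed.

HB.instance Definition _ := Lmodule_isAssocAlgebra.Build R[i] (linf R)
  linf_mulA linf_mulDl linf_mulDr linf_mulZl linf_mulZr.

Fact linf_norm_mul x y : `|amul x y| <= `|x| * `|y|.
Proof.
rewrite -[leRHS](rmorphM (real_complex R)) lecR; apply: linf_norm_le => n.
by rewrite rnormM ler_pM ?rnorm_ge0 ?linf_norm_ub.
Qed.

HB.instance Definition _ :=
  AssocAlgebra_Normed_isNormedAlgebra.Build R[i] (linf R) linf_norm_mul.

End linf.

Definition ell2_pred (R : realType) : {pred nat -> R[i]} :=
  mem [set x : nat -> R[i] | cvgn (series (fun n => rnorm (x n) ^+ 2))].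
Arguments ell2_pred : clear implicits.

Record ell2 (R : realType) := Ell2 {
  ell2_val :> nat -> R[i];
  ell2_valP : ell2_val \in ell2_pred R }.

HB.instance Definition _ (R : realType) := [isSub for @ell2_val R].
HB.instance Definition _ (R : realType) := [Choice of ell2 R by <:].

Section ell2.
Variable R : realType.
Implicit Types x y : ell2 R.

Let sqs (x : nat -> R[i]) : nat -> R := fun n => rnorm (x n) ^+ 2.

Let sqs_ge0 x n : 0 <= sqs x n. Proof. exact: sqr_ge0. Qed.

Let sqs0 : sqs (0 : nat -> R[i]) = (fun=> 0).
Proof. by apply/funext => n; rewrite /sqs rnorm0 expr0n. Qed.

Let sqsD_le (x y : nat -> R[i]) (t : R) n : 0 < t ->
  sqs (x + y) n <= (1 + t) * sqs x n + (1 + t^-1) * sqs y n.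
Proof.
move=> t0; set b := rnorm (x n); set c := rnorm (y n).
have h : sqs (x + y) n <= (b + c) ^+ 2.
  by rewrite /sqs ler_pXn2r ?nnegrE ?addr_ge0 ?rnorm_ge0 ?rnormD.
apply: (le_trans h); rewrite /sqs -/b -/c -subr_ge0.
have -> : (1 + t) * b ^+ 2 + (1 + t^-1) * c ^+ 2 - (b + c) ^+ 2 =
    t * (b - t^-1 * c) ^+ 2 by field; rewrite gt_eqF.
by rewrite mulr_ge0 ?sqr_ge0// ltW.
Qed.

Let sqsZ (a : R[i]) (x : nat -> R[i]) : sqs (a *: x) = rnorm a ^+ 2 *: sqs x.
Proof. by apply/funext => n; rewrite /sqs rnormM exprMn. Qed.

Lemma ell2_submod_closed : submod_closed (ell2_pred R).
Proof.
split.
  apply/mem_set; rewrite /= -/(sqs 0) sqs0.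
  have -> : series (fun=> 0 : R) = (fun=> 0).
    by apply/funext => n; rewrite /series/= big1.
  exact: is_cvg_cst.
move=> a x y /set_mem xl /set_mem yl; apply/mem_set.
have sqs_cvg : cvgn (series (2 *: (rnorm a ^+ 2 *: sqs x) + 2 *: sqs y)).
  apply: is_cvg_seriesD; apply: is_cvg_seriesZ => //.
  exact: is_cvg_seriesZ.
apply: series_le_cvg sqs_cvg => n; first exact: sqr_ge0.
  by apply: addr_ge0; apply: mulr_ge0 => //; [apply: mulr_ge0|]; exact: sqr_ge0.
by have := sqsD_le (a *: x) y n (@ltr01 R); rewrite invr1 sqsZ.
Qed.

HB.instance Definition _ :=
  GRing.isSubmodClosed.Build _ _ (ell2_pred R) ell2_submod_closed.
HB.instance Definition _ := [SubChoice_isSubLmodule of ell2 R by <:].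

Definition ell2_norm x : R :=
  Num.sqrt (limn (series (fun n => rnorm (x n) ^+ 2))).

Let cvg_sqs x : cvgn (series (sqs x)).
Proof. exact: set_mem (ell2_valP x). Qed.

Let le_sqs x n : sqs x n <= limn (series (sqs x)).
Proof.
have nd : nondecreasing_seq (series (sqs x)).
  by apply: nondecreasing_series => k _ _.
have := nondecreasing_cvgn_le nd (@cvg_sqs x) n.+1; apply: le_trans.
by rewrite seriesSr lerDr sumr_ge0.
Qed.

Lemma ell2_norm_ge0 x : 0 <= ell2_norm x. Proof. exact: sqrtr_ge0. Qed.

Lemma ell2_norm_sqr x :
  ell2_norm x ^+ 2 = limn (series (fun n => rnorm (x n) ^+ 2)).
Proof. by rewrite sqr_sqrtr// (le_trans (sqs_ge0 x 0%N))// le_sqs. Qed.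

Lemma ell2_norm0_eq0 x : (ell2_norm x)%:C = 0 -> x = 0.
Proof.
move=> /complexI x0; apply/val_inj/funext => n; apply: rnorm_eq0.
apply/eqP; rewrite -sqrf_eq0 eq_le sqr_ge0 andbT.
by rewrite (le_trans (le_sqs x n))// -ell2_norm_sqr x0 expr0n.
Qed.

Lemma ell2_normD x y :
  (ell2_norm (x + y))%:C <= (ell2_norm x)%:C + (ell2_norm y)%:C.
Proof.
have [/(congr1 (real_complex R))/ell2_norm0_eq0 ->|x0] := eqVneq (ell2_norm x) 0.
  by rewrite add0r lerDr lecR ell2_norm_ge0.
have [/(congr1 (real_complex R))/ell2_norm0_eq0 ->|y0] := eqVneq (ell2_norm y) 0.
  by rewrite addr0 lerDl lecR ell2_norm_ge0.
rewrite -rmorphD lecR -(@ler_pXn2r R 2) ?nnegrE ?addr_ge0 ?ell2_norm_ge0//.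
set a := ell2_norm x; set b := ell2_norm y; rewrite -/a in x0; rewrite -/b in y0.
have t0 : 0 < b / a.
  by rewrite divr_gt0// lt_def ?x0 ?y0 ell2_norm_ge0.
rewrite ell2_norm_sqr.
have -> : (a + b) ^+ 2 = (1 + b / a) * a ^+ 2 + (1 + (b / a)^-1) * b ^+ 2.
  by field; rewrite x0 y0.
rewrite !ell2_norm_sqr.
have cx := is_cvg_seriesZ (k := 1 + b / a) (@cvg_sqs x).
have cy := is_cvg_seriesZ (k := 1 + (b / a)^-1) (@cvg_sqs y).
have -> : (1 + b / a) * limn (series (sqs x)) +
    (1 + (b / a)^-1) * limn (series (sqs y)) =
    limn (series ((1 + b / a) *: sqs x + (1 + (b / a)^-1) *: sqs y)).
  by rewrite lim_seriesD// !lim_seriesZ//; exact: cvg_sqs.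
apply: lim_series_le.
- exact: (@cvg_sqs (x + y)).
- by rewrite seriesD; exact: is_cvgD.
- by move=> n; exact: sqsD_le.
Qed.

Lemma ell2_normZ (a : R[i]) x :
  (ell2_norm (a *: x))%:C = `|a| * (ell2_norm x)%:C.
Proof.
rewrite -rnormE -rmorphM; congr (_%:C).
rewrite /ell2_norm -/(sqs (a *: x)) -[X in series X]/(sqs (a *: (x : nat -> _))).
rewrite sqsZ lim_seriesZ//.
by rewrite sqrtrM ?sqr_ge0// sqrtr_sqr ger0_norm ?rnorm_ge0.
Qed.

HB.instance Definition _ := Lmodule_isNormed.Build R[i] (ell2 R)
  ell2_normD ell2_normZ ell2_norm0_eq0.

End ell2.

Definition bop_pred (R : realType) (V : normedModType R[i]) : {pred V -> V} :=
  mem [set T : V -> V | linear T /\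
    exists M : R, forall x, rnorm (T x) <= M * rnorm x].
Arguments bop_pred {R} V.

(* The bounded operators on [V]; [bop (ell2 R)] is B(l2). *)
Record bop (R : realType) (V : normedModType R[i]) := Bop {
  bop_fun :> V -> V;
  bop_funP : bop_fun \in bop_pred V }.

HB.instance Definition _ (R : realType) (V : normedModType R[i]) :=
  [isSub for @bop_fun R V].
HB.instance Definition _ (R : realType) (V : normedModType R[i]) :=
  [Choice of bop V by <:].

Section bop.
Variables (R : realType) (V : normedModType R[i]).
Implicit Types S T U : bop V.

Lemma bop_submod_closed : submod_closed (bop_pred V).
Proof.
split.
  apply/mem_set; split; first by move=> a u v; rewrite scaler0 addr0.
  by exists 0 => x; rewrite rnorm0 mul0r.
move=> a S T /set_mem[Sl [M SM]] /set_mem[Tl [N TN]]; apply/mem_set; split.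
  move=> b u v; rewrite -![(_ + T) _]/(a *: S _ + T _) Sl Tl !scalerDr.
  by rewrite !scalerA [b * a]mulrC addrACA.
exists (rnorm a * M + N) => x; rewrite (le_trans (rnormD _ _))//.
by rewrite mulrDl lerD// rnormZ -mulrA ler_wpM2l ?rnorm_ge0.
Qed.

HB.instance Definition _ :=
  GRing.isSubmodClosed.Build _ _ (bop_pred V) bop_submod_closed.
HB.instance Definition _ := [SubChoice_isSubLmodule of bop V by <:].

Lemma bop_linear T : linear T.
Proof. by have [] := set_mem (bop_funP T). Qed.

HB.instance Definition _ T :=
  GRing.isLinear.Build R[i] V V _ (bop_fun T) (bop_linear T).

Lemma bop_bounded T : exists M : R, forall x, rnorm (T x) <= M * rnorm x.
Proof. by have [] := set_mem (bop_funP T). Qed.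

Definition bop_norm T : R :=
  sup [set rnorm (T x) | x in [set x | rnorm x <= 1]].

Lemma bop_norm_ub T x : rnorm x <= 1 -> rnorm (T x) <= bop_norm T.
Proof.
move=> x1; apply: ub_le_sup; last by exists x.
have [M TM] := bop_bounded T; exists `|M| => _ [y y1 <-].
rewrite (le_trans (TM y))// (le_trans (ler_norm _))// normrM ler_piMr//.
by rewrite ger0_norm ?rnorm_ge0.
Qed.

Lemma bop_norm_le T M :
  (forall x, rnorm x <= 1 -> rnorm (T x) <= M) -> bop_norm T <= M.
Proof.
move=> TM; apply: ge_sup; last by move=> _ [x x1 <-]; exact: TM.
by exists (rnorm (T 0)), 0; rewrite //= rnorm0.
Qed.

Lemma bop_norm_ge0 T : 0 <= bop_norm T.
Proof. by apply: le_trans (rnorm_ge0 _) (@bop_norm_ub T 0 _); rewrite rnorm0. Qed.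

Lemma bop_norm_apply T x : rnorm (T x) <= bop_norm T * rnorm x.
Proof.
have [x0|x0] := eqVneq (rnorm x) 0.
  by rewrite (rnorm_eq0 x0) linear0 !rnorm0 mulr0.
have {}x0 : 0 < rnorm x by rewrite lt_def x0 rnorm_ge0.
have rC (r : R) : 0 <= r -> rnorm (r%:C : R[i]) = r.
  by move=> r0; rewrite /rnorm ger0_norm ?ler0c.
rewrite -ler_pdivrMr// mulrC -(rC (rnorm x)^-1) ?invr_ge0 ?rnorm_ge0//.
rewrite -rnormZ -linearZ; apply: bop_norm_ub.
by rewrite rnormZ rC ?invr_ge0 ?rnorm_ge0// mulVf// gt_eqF.
Qed.

Lemma bop_normD S T :
  (bop_norm (S + T))%:C <= (bop_norm S)%:C + (bop_norm T)%:C.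
Proof.
rewrite -rmorphD lecR; apply: bop_norm_le => x x1.
by rewrite (le_trans (rnormD _ _))// lerD ?bop_norm_ub.
Qed.

Lemma bop_normZ (a : R[i]) T : (bop_norm (a *: T))%:C = `|a| * (bop_norm T)%:C.
Proof.
rewrite -rnormE -rmorphM; congr (_%:C); apply/eqP; rewrite eq_le; apply/andP.
split.
  by apply: bop_norm_le => x x1; rewrite rnormZ ler_wpM2l ?rnorm_ge0 ?bop_norm_ub.
have [->|a0] := eqVneq (rnorm a) 0; first by rewrite mul0r bop_norm_ge0.
have {}a0 : 0 < rnorm a by rewrite lt_def a0 rnorm_ge0.
rewrite -ler_pdivlMl//; apply: bop_norm_le => x x1.
by rewrite ler_pdivlMl// -rnormZ; exact: (@bop_norm_ub (a *: T)).
Qed.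

Lemma bop_norm0_eq0 T : (bop_norm T)%:C = 0 -> T = 0.
Proof.
move=> /complexI T0; apply/val_inj/funext => x; apply: rnorm_eq0.
apply/eqP; rewrite eq_le rnorm_ge0 andbT.
by rewrite (le_trans (bop_norm_apply T x))// T0 mul0r.
Qed.

HB.instance Definition _ := Lmodule_isNormed.Build R[i] (bop V)
  bop_normD bop_normZ bop_norm0_eq0.

Fact bop_comp_subproof S T : (S \o T) \in bop_pred V.
Proof.
apply/mem_set; split; first by move=> a u v; rewrite /= !linearP.
exists (bop_norm S * bop_norm T) => x; rewrite (le_trans (bop_norm_apply S _))//.
by rewrite -mulrA ler_wpM2l ?bop_norm_ge0 ?bop_norm_apply.
Qed.

Definition bop_comp S T : bop V := Bop (bop_comp_subproof S T).

Fact bop_compA : associative bop_comp.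
Proof. by move=> S T U; apply/val_inj. Qed.

Fact bop_compDl : left_distributive bop_comp +%R.
Proof. by move=> S T U; apply/val_inj. Qed.

Fact bop_compDr : right_distributive bop_comp +%R.
Proof. by move=> S T U; apply/val_inj/funext => x; exact: linearD. Qed.

Fact bop_compZl (a : R[i]) S T : bop_comp (a *: S) T = a *: bop_comp S T.
Proof. by apply/val_inj. Qed.

Fact bop_compZr (a : R[i]) S T : bop_comp S (a *: T) = a *: bop_comp S T.
Proof. by apply/val_inj/funext => x; exact: linearZ. Qed.

HB.instance Definition _ := Lmodule_isAssocAlgebra.Build R[i] (bop V)
  bop_compA bop_compDl bop_compDr bop_compZl bop_compZr.

Fact bop_norm_comp S T : `|amul S T| <= `|S| * `|T|.
Proof.
rewrite -[leRHS](rmorphM (real_complex R)) lecR; apply: bop_norm_le => x x1.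
rewrite (le_trans (bop_norm_apply S _))//.
by rewrite ler_wpM2l ?bop_norm_ge0 ?bop_norm_ub.
Qed.

HB.instance Definition _ :=
  AssocAlgebra_Normed_isNormedAlgebra.Build R[i] (bop V) bop_norm_comp.

Fact bop_id_subproof : id \in bop_pred V.
Proof. by apply/mem_set; split=> //; exists 1 => x; rewrite mul1r. Qed.

Definition bop_id : bop V := Bop bop_id_subproof.

Definition compact_op : set (bop V) :=
  [set T | precompact (T @` [set x | `|x| <= 1])].

(* The scalar perturbations [K + c 1] of compact operators; the sum of the two
   subspaces is direct as soon as [V] is infinite-dimensional. *)
Definition compact_op_unitization : set (bop V) :=
  [set T | exists2 K, compact_op K & exists c : R[i], T = K + c *: bop_id].

End bop.
Arguments bop_id {R} V.
Arguments compact_op {R} V.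
Arguments compact_op_unitization {R} V.

(* Embeddings only involve the linear structure and either the product or the
   norm of the target, so the targets are taken to be normed algebras. *)
Section embeddings.
Variable R : realType.

Definition algebra_embedding (A : assocAlgType R[i]) (B : normedAlgType R[i])
    (phi : {linear A -> B}) : Prop :=
  injective phi /\ forall x y, phi (amul x y) = amul (phi x) (phi y).

Definition algebra_embeddable (A : assocAlgType R[i])
    (B : normedAlgType R[i]) : Prop :=
  exists phi : {linear A -> B}, algebra_embedding phi.

Definition algebra_embeddable_off (A : assocAlgType R[i])
    (B : normedAlgType R[i]) (Y : set B) : Prop :=
  exists2 phi : {linear A -> B},
    algebra_embedding phi & range phi `&` Y = [set 0].

Definition banach_embedding (A : completeNormedModType R[i])
    (B : normedAlgType R[i]) (phi : {linear A -> B}) : Prop :=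
  injective phi /\ forall x, `|phi x| = `|x|.

Definition banach_embeddable (A : completeNormedModType R[i])
    (B : normedAlgType R[i]) : Prop :=
  exists phi : {linear A -> B}, banach_embedding phi.

Definition banach_embeddable_off (A : completeNormedModType R[i])
    (B : normedAlgType R[i]) (Y : set B) : Prop :=
  exists2 phi : {linear A -> B},
    banach_embedding phi & range phi `&` Y = [set 0].

End embeddings.

(* Main.v *)
Require Import Defs.
From HB Require Import structures.
From mathcomp Require Import all_boot all_order all_algebra.
From mathcomp Require Import all_classical all_reals all_analysis.
From mathcomp Require Import complex.

(** A bounded sequence [d] acts on l2 as a diagonal operator, which embeds
l_infinity in B(l2) linearly, multiplicatively and isometrically.  This
embedding meets the unitization of the compact operators: it sends c_0 to
compact operators and the constant sequences to the scalars.  The cure is to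
repeat each entry of [d] infinitely often, together with infinitely many
zeros, before forming the diagonal operator ([spread]); this is a linear,
multiplicative and isometric (though not unital) map of l_infinity into itself.

Suppose that the diagonal operator of such a spread sequence is [K + c 1] with
[K] compact.  Each value [b] of the sequence is then taken infinitely often, so
[K] has the eigenvalue [b - c] on infinitely many basis vectors.  These unit
vectors stay at distance at least 1 from one another, and a compact operator
admits such a family of eigenvectors only for the eigenvalue 0
([compact_op_separated_eigenvectors]).  Hence [b = c] for every value [b]; as 0
is a value, [c = 0] and the sequence vanishes
([diag_op_compact_unitization_eq0]).

Composing an arbitrary embedding in l_infinity with this single map
([spread_diag_op]) settles algebras and Banach spaces at once. *)

Set Implicit Arguments.
Unset Strict Implicit.
Unset Printing Implicit Defensive.

Import Order.TTheory GRing.Theory Num.Theory.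
Import numFieldNormedType.Exports.

Local Open Scope classical_set_scope.
Local Open Scope ring_scope.
Local Open Scope complex_scope.

(** * Eigenvectors of compact operators *)

Section compact_operators.
Variables (R : realType) (V : normedModType R[i]).

(** The vectors [K (u n) = a *: u n] lie in a compact set, so they accumulate
at a point and, if [a != 0], two of them with different indices are at distance
less than [`|a|]; but the separation
of the [u n] keeps them at distance at least [`|a|]. *)
Lemma compact_op_separated_eigenvectors (K : bop V) (a : R[i]) (u : nat -> V) :
  compact_op V K -> (forall n, `|u n| <= 1) ->
  (forall m n, m != n -> 1 <= `|u m - u n|) ->
  (forall n, K (u n) = a *: u n) -> a = 0.
Proof.
move=> [D imK [cD _]] u1 usep Ku; apply: contrapT => /eqP a0.
have a_gt0 : 0 < `|a| by rewrite normr_gt0.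
pose w n := K (u n).
have [|p [_ wp]] := cD (w @ \oo) _.
  by exists 0%N => // n _; apply: imK; exists (u n) => //; exact: u1.
have meet N : exists2 n, (N <= n)%N & `|p - w n| < `|a| / 2.
  have [||_ [[n Nn <-] pn]] := wp (w @` [set n | (N <= n)%N]) (ball p (`|a| / 2)).
  - by exists N => // n Nn; exists n.
  - by apply: nbhsx_ballx; rewrite divr_gt0.
  - by exists n => //; move: pn; rewrite -ball_normE.
have [n _ pn] := meet 0%N; have [m nm pm] := meet n.+1.
have : `|w m - w n| < `|a|.
  rewrite -(subrKA p) (splitr `|a|) (le_lt_trans (ler_normD _ _))//.
  by rewrite ltrD// distrC.
rewrite /w !Ku -scalerBr normrZ; apply/negP; rewrite real_ltNge ?realM ?normr_real//.
by rewrite negbK ler_peMr ?normr_ge0// usep// gtn_eqF.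
Qed.

Lemma compact_op0 : compact_op V 0.
Proof.
exists [set 0]; first by move=> _ [x _ <-].
split; first exact: compact_set1.
exact/accessible_closed_set1/hausdorff_accessible/norm_hausdorff.
Qed.

End compact_operators.

(** * The standard basis of l2 *)

Section basis.
Variable R : realType.
Implicit Types x : ell2 R.

Lemma ell2_coord_le x n : rnorm (x n) <= rnorm x.
Proof.
rewrite -(@ler_pXn2r R 2) ?nnegrE ?rnorm_ge0// ell2_norm_sqr.
have nd : nondecreasing_seq (series (fun k => rnorm (x k) ^+ 2)).
  by apply: nondecreasing_series => k _ _; exact: sqr_ge0.
apply: le_trans (nondecreasing_cvgn_le nd (set_mem (ell2_valP x)) n.+1).
by rewrite seriesSr lerDr sumr_ge0// => k _; exact: sqr_ge0.
Qed.

Lemma delta_series (n N : nat) : (n < N)%N ->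
  series (fun k => rnorm ((k == n)%:R : R[i]) ^+ 2) N = 1.
Proof.
move=> nN; rewrite /series/= big_mkord (bigD1 (Ordinal nN))//= eqxx.
rewrite big1 => [|k]; last by rewrite -val_eqE/= => /negPf ->; rewrite rnorm0 expr0n.
by rewrite /rnorm normr1 addr0 expr1n.
Qed.

Let near_delta (n : nat) :
  \forall N \near \oo, series (fun k => rnorm ((k == n)%:R : R[i]) ^+ 2) N = 1.
Proof. by exists n.+1 => // N /= nN; exact: delta_series. Qed.

Fact ell2_delta_subproof (n : nat) : (fun k => (k == n)%:R) \in ell2_pred R.
Proof. by apply/mem_set; apply: is_cvg_near_cst (near_delta n). Qed.

Definition ell2_delta n : ell2 R := Ell2 (ell2_delta_subproof n).

Lemma rnorm_ell2_delta n : rnorm (ell2_delta n) = 1.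
Proof.
by rewrite /rnorm/= /ell2_norm/= (lim_near_cst _ (near_delta n))// sqrtr1.
Qed.

(** The weak bound 1, instead of the exact distance [sqrt 2], can be read off
the single coordinate [m]. *)
Lemma ell2_delta_dist m n : m != n -> 1 <= `|ell2_delta m - ell2_delta n|.
Proof.
move=> mn; rewrite -rnormE -[1]/(1%:C) lecR.
apply: le_trans (ell2_coord_le _ m).
rewrite -[X in rnorm X]/((m == m)%:R - (m == n)%:R) eqxx (negPf mn) subr0.
by rewrite /rnorm normr1.
Qed.

End basis.

(** * Diagonal operators *)

Section diagonal.
Variable R : realType.
Implicit Types (d : linf R) (x : ell2 R).

Let diag_le d x n :
  rnorm (d n * x n) ^+ 2 <= linf_norm d ^+ 2 * rnorm (x n) ^+ 2.
Proof.
by rewrite rnormM exprMn ler_wpM2r ?sqr_ge0// ler_pXn2r ?nnegrE ?rnorm_ge0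
  ?linf_norm_ge0 ?linf_norm_ub.
Qed.

Fact diag_vec_subproof d x : (fun n => d n * x n) \in ell2_pred R.
Proof.
apply/mem_set; apply: series_le_cvg (diag_le d x) _.
- by move=> n; exact: sqr_ge0.
- by move=> n; rewrite mulr_ge0 ?sqr_ge0.
- exact: (is_cvg_seriesZ (k := linf_norm d ^+ 2) (set_mem (ell2_valP x))).
Qed.

Definition diag_vec d x : ell2 R := Ell2 (diag_vec_subproof d x).

Lemma rnorm_diag_vec d x : rnorm (diag_vec d x) <= rnorm d * rnorm x.
Proof.
rewrite -(@ler_pXn2r R 2) ?nnegrE ?mulr_ge0 ?rnorm_ge0// exprMn !ell2_norm_sqr.
have cx := set_mem (ell2_valP x).
have := lim_seriesZ (linf_norm d ^+ 2) cx; rewrite -[RHS]/(_ * _) => <-.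
apply: lim_series_le (diag_le d x); first exact: set_mem (ell2_valP (diag_vec d x)).
exact: (is_cvg_seriesZ (k := linf_norm d ^+ 2) cx).
Qed.

Fact diag_op_subproof d : diag_vec d \in bop_pred (ell2 R).
Proof.
apply/mem_set; split; last by exists (rnorm d) => x; exact: rnorm_diag_vec.
by move=> a x y; apply/val_inj/funext => n; rewrite /= mulrDr mulrCA.
Qed.

Definition diag_op d : bop (ell2 R) := Bop (diag_op_subproof d).

Fact diag_op_linear : linear diag_op.
Proof.
move=> a d e; apply/val_inj/funext => x; apply/val_inj/funext => n.
by rewrite /= mulrDl -mulrA.
Qed.

HB.instance Definition _ :=
  GRing.isLinear.Build R[i] (linf R) (bop (ell2 R)) _ diag_op diag_op_linear.

Lemma diag_opM d e : diag_op (amul d e) = amul (diag_op d) (diag_op e).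
Proof.
apply/val_inj/funext => x; apply/val_inj/funext => n.
by rewrite /= mulrA.
Qed.

Lemma diag_op_delta d n : diag_op d (ell2_delta R n) = d n *: ell2_delta R n.
Proof.
apply/val_inj/funext => k; rewrite /= -[RHS]/(d n * (k == n)%:R).
by have [->//|_] := eqVneq k n; rewrite !mulr0.
Qed.

Lemma norm_diag_op d : `|diag_op d| = `|d|.
Proof.
rewrite -!rnormE; congr (_%:C); apply/eqP; rewrite eq_le; apply/andP; split.
  apply: bop_norm_le => x x1; rewrite (le_trans (rnorm_diag_vec d x))//.
  by rewrite ler_piMr ?rnorm_ge0.
apply: linf_norm_le => n; have := bop_norm_apply (diag_op d) (ell2_delta R n).
by rewrite diag_op_delta rnormZ rnorm_ell2_delta !mulr1.
Qed.

(** An operator [diag_op d - c *: bop_id] is again diagonal, so its compactness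
forces all its infinitely repeated entries to vanish. *)
Lemma diag_op_compact_unitization_eq0 d :
  (forall k, exists2 s : nat -> nat, injective s & forall j, d (s j) = d k) ->
  (exists2 s : nat -> nat, injective s & forall j, d (s j) = 0) ->
  compact_op_unitization (ell2 R) (diag_op d) -> d = 0.
Proof.
move=> drep [s0 s0_inj ds0] [K cK [c dKc]].
have KE : K = diag_op d - c *: bop_id (ell2 R) by rewrite dKc addrK.
have eigen (s : nat -> nat) b : injective s -> (forall j, d (s j) = b) ->
    b - c = 0.
  move=> s_inj dsb.
  apply: (compact_op_separated_eigenvectors (u := ell2_delta R \o s) cK).
  - by move=> j; rewrite -rnormE rnorm_ell2_delta.
  - by move=> i j ij; apply: ell2_delta_dist; rewrite inj_eq.
  - move=> j; rewrite KE -[LHS]/(diag_op d (ell2_delta R (s j)) -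
      c *: ell2_delta R (s j)) diag_op_delta dsb.
    by rewrite -scalerBl.
have c0 : c = 0 by apply/eqP; rewrite -oppr_eq0 -sub0r; apply/eqP; exact: eigen ds0.
apply/val_inj/funext => k; have [s s_inj dsk] := drep k.
by have := eigen s _ s_inj dsk; rewrite c0 subr0.
Qed.

End diagonal.

(** * Repeating every entry infinitely often *)

(** The value [Some k] marks the positions that receive the [k]-th entry, the
value [None] those that receive 0.  Decoding pairs and forgetting the second
component makes every fiber infinite. *)
Definition spread_index (n : nat) : option nat :=
  obind (fun p : option nat * nat => p.1) (unpickle n).

Lemma spread_index_fiber (o : option nat) :
  exists2 s : nat -> nat, injective s & forall j, spread_index (s j) = o.
Proof.
exists (fun j => pickle (o, j)); last by move=> j; rewrite /spread_index pickleK.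
by move=> i j /(pcan_inj pickleK)[].
Qed.

Section spread.
Variable R : realType.
Implicit Types d e : linf R.

Definition spread_seq (d : nat -> R[i]) (n : nat) : R[i] :=
  oapp d 0 (spread_index n).

Let rnorm_spread_seq d n : rnorm (spread_seq d n) <= linf_norm d.
Proof.
rewrite /spread_seq; case: spread_index => [k|] /=; first exact: linf_norm_ub.
by rewrite rnorm0 linf_norm_ge0.
Qed.

Fact spread_subproof d : spread_seq d \in linf_pred R.
Proof. by apply/mem_set; exists (linf_norm d); exact: rnorm_spread_seq. Qed.

Definition spread d : linf R := Linf (spread_subproof d).

Fact spread_linear : linear spread.
Proof.
move=> a d e; apply/val_inj/funext => n.
rewrite /= -[RHS]/(a * spread_seq d n + spread_seq e n) /spread_seq.
by case: spread_index => [k|] //=; rewrite mulr0 addr0.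
Qed.

HB.instance Definition _ :=
  GRing.isLinear.Build R[i] (linf R) (linf R) _ spread spread_linear.

Lemma spreadM d e : spread (amul d e) = amul (spread d) (spread e).
Proof.
apply/val_inj/funext => n; rewrite /= /spread_seq.
by case: spread_index => [k|] //=; rewrite mulr0.
Qed.

Lemma norm_spread d : `|spread d| = `|d|.
Proof.
rewrite -!rnormE; congr (_%:C); apply/eqP; rewrite eq_le; apply/andP; split.
  by apply: linf_norm_le => n; exact: rnorm_spread_seq.
apply: linf_norm_le => k; have [s _ sk] := spread_index_fiber (Some k).
by have := linf_norm_ub (spread d) (s 0%N); rewrite /= /spread_seq sk.
Qed.

Definition spread_diag_op : linf R -> bop (ell2 R) := @diag_op R \o spread.

HB.instance Definition _ := GRing.Linear.on spread_diag_op.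

Lemma norm_spread_diag_op d : `|spread_diag_op d| = `|d|.
Proof. by rewrite norm_diag_op norm_spread. Qed.

Lemma spread_diag_op_inj : injective spread_diag_op.
Proof.
move=> d e /eqP; rewrite -subr_eq0 -linearB -normr_eq0 norm_spread_diag_op.
by rewrite normr_eq0 subr_eq0 => /eqP.
Qed.

Lemma spread_diag_op_compact_unitization_eq0 d :
  compact_op_unitization (ell2 R) (spread_diag_op d) -> d = 0.
Proof.
move=> /diag_op_compact_unitization_eq0 spread0.
apply/eqP; rewrite -normr_eq0 -norm_spread normr_eq0; apply/eqP/spread0.
  move=> n; have [s s_inj sE] := spread_index_fiber (spread_index n).
  by exists s => // j; rewrite /= /spread_seq sE.
have [s s_inj sE] := spread_index_fiber None.
by exists s => // j; rewrite /= /spread_seq sE.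
Qed.

Lemma range_spread_diag_op (A : lmodType R[i]) (phi : {linear A -> linf R}) :
  range (spread_diag_op \o phi) `&` compact_op_unitization (ell2 R) = [set 0].
Proof.
apply/seteqP; split=> [_ [[x _ <-]]|_ ->].
  by move=> /spread_diag_op_compact_unitization_eq0/= ->; rewrite linear0.
split; first by exists 0 => //; rewrite linear0.
by exists 0; [exact: compact_op0 | exists 0; rewrite scale0r addr0].
Qed.

End spread.

Theorem corollary2p13 (R : realType) :
  (forall A : assocAlgType R[i],
     algebra_embeddable A (linf R) ->
     algebra_embeddable_off A (compact_op_unitization (ell2 R))) /\
  (forall A : completeNormedModType R[i],
     banach_embeddable A (linf R) ->
     banach_embeddable_off A (compact_op_unitization (ell2 R))).
Proof.
split=> A [phi [phi_inj phiP]]; exists (@spread_diag_op R \o phi);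
  (try exact: range_spread_diag_op); split.
- exact: inj_comp (@spread_diag_op_inj R) phi_inj.
- by move=> x y; rewrite /= phiP /spread_diag_op/= spreadM diag_opM.
- exact: inj_comp (@spread_diag_op_inj R) phi_inj.
- by move=> x; rewrite /= norm_spread_diag_op phiP.
Qed.
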